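(* Let $n\ge1$ be an integer, let $a,b,m$ be constants, and work where $a\cos mx+b\sin mx\neq0$. The operational identity $$\prod_{k=n}^{0}\left(D-km\frac{-a\sin mx+b\cos mx}{a\cos mx+b\sin mx}\right)=\left(a\cos mx+b\sin mx\right)^{n+1}\left(\frac1{a\cos mx+b\sin mx}D\right)^{n+1}$$ holds, and: (i) by virtue of this identity, the equation $$y_n''-\left(\lambda+\frac{m^2(a^2+b^2)n(n+1)}{(a\cos mx+b\sin mx)^2}\right)y_n=0,\qquad\lambda\neq0,$$ has general solution $$y_n=\left(a\cos mx+b\sin mx\right)^{n+1}\left(\frac1{a\cos mx+b\sin mx}D\right)^{n+1}y_0,$$ where $y_0$ is the general solution of $y_0''-\lambda y_0=0$, taken in one of its exponential, hyperbolic or trigonometric forms; (ii) if $\lambda=-m^2(n+1)^2$, then by virtue of the factorization $$D^2+m^2(n+1)^2-\frac{n(n+1)m^2(a^2+b^2)}{(a\cos mx+b\sin mx)^2}=\left[D+m(n+1)\frac{-a\sin mx+b\cos mx}{a\cos mx+b\sin mx}\right]\left[D-m(n+1)\frac{-a\sin mx+b\cos mx}{a\cos mx+b\sin mx}\right]$$ the equation $$y''+m^2(n+1)^2y-\frac{n(n+1)m^2(a^2+b^2)}{(a\cos mx+b\sin mx)^2}y=0$$ has general solution $$y=(a\cos mx+b\sin mx)^{n+1}\left[c_1+c_2\int(a\cos mx+b\sin mx)^{-2(n+1)}dx\right].$$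
   Context: $D=d/dx$. A product $\prod_{k=n}^{0}L_k$ denotes the composition $L_nL_{n-1}\cdots L_0$ ($L_0$ is applied first). Functions act by multiplication, so $\frac1fD$ sends $y$ to $y'/f$. The forms of $y_0$ are $y_0=c_1e^{\sqrt\lambda x}+c_2e^{-\sqrt\lambda x}$; $y_0=c_1\cosh(\sqrt\lambda x)+c_2\sinh(\sqrt\lambda x)$ for $\lambda>0$; $y_0=c_1\cos(\sqrt{-\lambda}x)+c_2\sin(\sqrt{-\lambda}x)$ for $\lambda<0$. Here and in (ii), $c_1,c_2$ are arbitrary constants, and $\int$ denotes an antiderivative.
   Formalization: In (i), that the formula gives all solutions is claimed only if λ ≠ -m²k² for k=1,…,n; otherwise it fails: for n=1, a=m=1, b=0, λ=-1 it yields only -c₁/cos x. That every yₙ is a solution is kept for all λ≠0. *)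

(* Defs.v *)
From Stdlib Require Import Reals Lra Lia.
From Coquelicot Require Import Coquelicot.
Open Scope R_scope.

(* The independent variable is real and ranges over an open interval; the
   unknown functions are real-valued or complex-valued, with arbitrary constants
   taken in the same field. *)
Inductive scalars : Set := real_scalars | complex_scalars.

Definition carrier (K : scalars) : CompleteNormedModule R_AbsRing :=
  match K with
  | real_scalars => R_CompleteNormedModule
  | complex_scalars => C_R_CompleteNormedModule
  end.

Definition Rbar_interval (al be : Rbar) (x : R) : Prop :=
  Rbar_lt al x /\ Rbar_lt x be.

Lemma is_derive_inj {V : NormedModule R_AbsRing} (y : R -> V) (x : R) (l1 l2 : V) :
  is_derive y x l1 -> is_derive y x l2 -> l1 = l2.
Proof.
intros H1 H2.
assert (H := is_derive_minus _ _ _ _ _ H1 H2).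
assert (H0 : is_derive (fun _ : R => zero : V) x (minus l1 l2)).
{ apply (is_derive_ext (fun t => minus (y t) (y t))); [|exact H].
  intros t; apply (plus_opp_r (G := V)). }
clear H H1 H2.
destruct H0 as [_ H0].
specialize (H0 x (fun P HP => HP)).
assert (Hn : norm (minus l1 l2) <= 0).
{ apply le_epsilon; intros e He.
  destruct (H0 (mkposreal e He)) as [d Hd].
  assert (Hb : ball x d (x + d / 2)).
  { change (Rabs (x + d / 2 - x) < d).
    replace (x + d / 2 - x) with (d / 2) by ring.
    rewrite Rabs_pos_eq; destruct d as [d d0]; simpl; lra. }
  specialize (Hd _ Hb); simpl in Hd.
  assert (Hm : @minus R_AbelianGroup (x + d / 2) x = d / 2).
  { change (x + d / 2 - x = d / 2); ring. }
  change (norm (plus (minus zero zero)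
            (opp (scal (@minus R_AbelianGroup (x + d / 2) x) (minus l1 l2))))
          <= e * Rabs (@minus R_AbelianGroup (x + d / 2) x)) in Hd.
  rewrite Hm in Hd; unfold minus at 1 in Hd.
  rewrite (plus_opp_r (G := V)), (plus_zero_l (G := V)), (norm_opp (V := V)) in Hd.
  assert (d0 : 0 < d / 2) by (destruct d as [d d0]; simpl; lra).
  assert (E : norm (minus l1 l2)
              = norm (scal (/ (d / 2)) (scal (d / 2) (minus l1 l2)))).
  { rewrite scal_assoc.
    change (mult (/ (d / 2)) (d / 2)) with (/ (d / 2) * (d / 2)).
    rewrite Rinv_l by lra. now rewrite (scal_one (K := R_AbsRing)). }
  rewrite E.
  eapply Rle_trans; [apply (norm_scal (K := R_AbsRing))|].
  change (abs (/ (d / 2))) with (Rabs (/ (d / 2))).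
  rewrite Rabs_pos_eq by (left; now apply Rinv_0_lt_compat).
  rewrite (Rabs_pos_eq (d / 2)) in Hd by lra.
  apply Rle_trans with (/ (d / 2) * (e * (d / 2))).
  - apply Rmult_le_compat_l; [left; now apply Rinv_0_lt_compat|exact Hd].
  - right; field; lra. }
assert (Hz : minus l1 l2 = zero).
{ apply norm_eq_zero, Rle_antisym; [exact Hn|apply norm_ge_0]. }
apply (plus_reg_r (opp l2)).
rewrite (plus_opp_r (G := V)); exact Hz.
Qed.

Section Operators.

Context {V : CompleteNormedModule R_AbsRing}.

(* d/dx as a total operator: [Dop y x] is the derivative of [y] at [x] whenever
   it exists, see [Dop_correct] and [Dop_unique] below. *)
Definition Dop (y : R -> V) : R -> V := fun x => iota (is_derive y x).

Definition op_fun (g : R -> R) (y : R -> V) : R -> V :=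
  fun x => scal (g x) (y x).

Definition op_plus (L M : (R -> V) -> (R -> V)) (y : R -> V) : R -> V :=
  fun x => plus (L y x) (M y x).

Definition op_minus (L M : (R -> V) -> (R -> V)) (y : R -> V) : R -> V :=
  fun x => minus (L y x) (M y x).

Definition op_comp (L M : (R -> V) -> (R -> V)) (y : R -> V) : R -> V :=
  L (M y).

(* L_n L_(n-1) ... L_0, with L_0 applied first. *)
Fixpoint op_prod (L : nat -> (R -> V) -> (R -> V)) (n : nat) (y : R -> V)
  : R -> V :=
  match n with
  | O => L O y
  | S p => L n (op_prod L p y)
  end.

Definition op_pow (L : (R -> V) -> (R -> V)) (n : nat) (y : R -> V) : R -> V :=
  Nat.iter n L y.

(* [y] is [k] times differentiable at every point of [I]. *)
Definition derivable_on (I : R -> Prop) (k : nat) (y : R -> V) : Prop :=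
  forall j x, (j < k)%nat -> I x -> ex_derive (op_pow Dop j y) x.

(* [y] is a solution on [I] of the second order linear equation [L y = 0]. *)
Definition solution (I : R -> Prop) (L : (R -> V) -> (R -> V)) (y : R -> V)
  : Prop :=
  derivable_on I 2 y /\ forall x, I x -> L y x = zero.

Definition general_solution (I : R -> Prop) (L : (R -> V) -> (R -> V))
  (Y : V -> V -> R -> V) : Prop :=
  (forall c1 c2, solution I L (Y c1 c2)) /\
  (forall y, solution I L y ->
     exists c1 c2, forall x, I x -> y x = Y c1 c2 x).

Lemma Dop_unique (y : R -> V) (x : R) (l : V) : is_derive y x l -> Dop y x = l.
Proof.
intros H; apply iota_unique; [|exact H].
intros l' H'; exact (is_derive_inj _ _ _ _ H' H).
Qed.

Lemma Dop_correct (y : R -> V) (x : R) :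
  ex_derive y x -> is_derive y x (Dop y x).
Proof. now intros [l H]; rewrite (Dop_unique _ _ _ H). Qed.

End Operators.

Definition trig_f (a b m x : R) : R := a * cos (m * x) + b * sin (m * x).

Definition trig_r (a b m x : R) : R :=
  (- a * sin (m * x) + b * cos (m * x)) / (a * cos (m * x) + b * sin (m * x)).

(* y'' - q y *)
Definition schrodinger_op {V : CompleteNormedModule R_AbsRing} (q : R -> R)
  : (R -> V) -> (R -> V) :=
  op_minus (op_pow Dop 2) (op_fun q).

(* The principal square root of a real number [lam]; [sqrt] is 0 on negative
   numbers, so this is [sqrt lam] if [0 <= lam] and [i sqrt (- lam)] if
   [lam <= 0]. *)
Definition csqrt (lam : R) : C := (sqrt lam, sqrt (- lam)).

Definition cexp (z : C) : C := (exp (Re z) * cos (Im z), exp (Re z) * sin (Im z)).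

(* The forms of the general solution of y_0'' - lam y_0 = 0.  The exponential
   form makes sense over the reals for [0 < lam] only. *)
Inductive y0_form (lam : R) :
  forall K : scalars, (carrier K -> carrier K -> R -> carrier K) -> Prop :=
  | exponential_real : 0 < lam ->
      y0_form lam real_scalars
        (fun c1 c2 x : R =>
           c1 * exp (sqrt lam * x) + c2 * exp (- sqrt lam * x))
  | exponential_complex :
      y0_form lam complex_scalars
        (fun (c1 c2 : C) (x : R) =>
           (c1 * cexp (csqrt lam * x) + c2 * cexp (- csqrt lam * x))%C)
  | hyperbolic (K : scalars) : 0 < lam ->
      y0_form lam K
        (fun c1 c2 x => plus (scal (cosh (sqrt lam * x)) c1)
                             (scal (sinh (sqrt lam * x)) c2))
  | trigonometric (K : scalars) : lam < 0 ->
      y0_form lam K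
        (fun c1 c2 x => plus (scal (cos (sqrt (- lam) * x)) c1)
                             (scal (sin (sqrt (- lam) * x)) c2)).

(* Main.v *)
Require Import Defs.
From Stdlib Require Import Reals Lra Lia Classical FunctionalExtensionality.
From Coquelicot Require Import Coquelicot.
Open Scope R_scope.

(** Write f = a cos mx + b sin mx and w = m r = f'/f.  Since f'' = - m^2 f, the
    function w satisfies the Riccati equation w' = - (w^2 + m^2), and
    S := w^2 + m^2 equals m^2 (a^2 + b^2) / f^2.  The
    argument runs with the ladder operators A_k = D - k w, for any r with
    r' = - m (r^2 + 1) and any nonvanishing f with f' = m r f.

    The operational identity is a telescoping of D f^k = f^k (D + k w): it gives
    A_k f^k = f^k D, so that A_n ... A_1 A_0 = f^(n+1) ((1/f) D)^(n+1)
    (ladder_product_eq).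

    For (i), the Riccati equation yields
      A_(-k) A_k = D^2 - k (k - 1) S + k^2 m^2.
    Hence A_k maps solutions of y'' = (lam + k (k - 1) S) y to solutions of
    y'' = (lam + k (k + 1) S) y (ladder_solution), and on the former A_(-k) A_k
    is multiplication by lam + k^2 m^2.  When this number is nonzero, A_k is onto
    (ladder_surjective).  Climbing from k = 0 to k = n turns the general solution
    of y'' = lam y into solutions of the required equation, and into all of them
    if no lam + k^2 m^2 vanishes for 0 <= k <= n.

    For (ii), k = n + 1 and lam = - m^2 (n + 1)^2 make the constant vanish, so
    the equation is A_(-k) A_k y = 0.  It is integrated twice, with f^k as
    integrating factor for A_(-k) and f^(-k) for A_k
    (general_solution_resonant). *)

(** * Linear identities between vectors *)

(** Records the coordinates of a vector on two given vectors, which need not be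
    independent.  Computing the coordinates of both sides of an identity reduces
    it to two identities between real numbers. *)
Definition lin {V : CompleteNormedModule R_AbsRing} (u v x : V) (p q : R) : Prop :=
  x = plus (scal p u) (scal q v).

Section Lin.

Context {V : CompleteNormedModule R_AbsRing} (u v : V).

Lemma lin_left : lin u v u 1 0.
Proof.
unfold lin. rewrite (scal_one (K := R_AbsRing)), (scal_zero_l (K := R_AbsRing)).
now rewrite plus_zero_r.
Qed.

Lemma lin_right : lin u v v 0 1.
Proof.
unfold lin. rewrite (scal_one (K := R_AbsRing)), (scal_zero_l (K := R_AbsRing)).
now rewrite plus_zero_l.
Qed.

Lemma lin_zero : lin u v zero 0 0.
Proof.
unfold lin. rewrite !(scal_zero_l (K := R_AbsRing)). now rewrite plus_zero_l.
Qed.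

Lemma lin_plus (x y : V) (p q p' q' : R) :
  lin u v x p q -> lin u v y p' q' -> lin u v (plus x y) (p + p') (q + q').
Proof.
unfold lin; intros -> ->.
change (p + p') with (plus p p'); change (q + q') with (plus q q').
rewrite !(scal_distr_r (K := R_AbsRing)), <- !plus_assoc. f_equal.
rewrite !plus_assoc. f_equal. apply plus_comm.
Qed.

Lemma lin_scal (k : R) (x : V) (p q : R) :
  lin u v x p q -> lin u v (scal k x) (k * p) (k * q).
Proof.
unfold lin; intros ->.
rewrite (scal_distr_l (K := R_AbsRing)), !(scal_assoc (K := R_AbsRing)).
reflexivity.
Qed.

Lemma lin_opp (x : V) (p q : R) : lin u v x p q -> lin u v (opp x) (- p) (- q).
Proof.
unfold lin; intros ->.
change (- p) with (opp p); change (- q) with (opp q).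
now rewrite !(scal_opp_l (K := R_AbsRing)), (opp_plus (G := V)).
Qed.

Lemma lin_eq (x y : V) (p q p' q' : R) :
  lin u v x p q -> lin u v y p' q' -> p = p' -> q = q' -> x = y.
Proof. unfold lin; intros -> -> -> ->; reflexivity. Qed.

End Lin.

Ltac lin_reify :=
  repeat first
    [ apply lin_left | apply lin_right | apply lin_zero
    | unfold minus at 1; apply lin_plus | apply lin_plus
    | apply lin_scal | apply lin_opp ].

Ltac vector_eq u v :=
  eapply (lin_eq u v); [ solve [lin_reify] | solve [lin_reify] | | ].

(** * Differentiation on an open set *)

Section Calculus.

Context {V : CompleteNormedModule R_AbsRing}.

Lemma is_derive_scal_fun (g : R -> R) (y : R -> V) (x dg : R) (dy : V) :
  is_derive g x dg -> is_derive y x dy ->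
  is_derive (fun t : R => scal (g t) (y t)) x
    (plus (scal dg (y x)) (scal (g x) dy)).
Proof.
intros Hg Hy.
eapply filterdiff_ext_lin;
  [exact (filterdiff_scal_fct x g y _ _ Rmult_comm Hg Hy)|].
(* A derivative is the linear map sending t to t times its value. *)
intros t.
change (plus (scal (t * dg) (y x)) (scal (g x) (scal (t : R) dy))
        = scal (t : R) (plus (scal dg (y x)) (scal (g x) dy))).
vector_eq (y x) dy; ring.
Qed.

Lemma is_derive_const_scal (c : R) (y : R -> V) (x : R) (l : V) :
  is_derive y x l -> is_derive (fun t : R => scal c (y t)) x (scal c l).
Proof.
intros H; eapply eq_rect;
  [exact (is_derive_scal_fun (fun _ => c) y x 0 l
            (is_derive_const (V := R_NormedModule) c x) H)|].
vector_eq (y x) l; ring.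
Qed.

Context (I : R -> Prop) (open_I : open I).

Lemma is_derive_ext_on (y z : R -> V) (x : R) (l : V) :
  (forall t, I t -> y t = z t) -> I x -> is_derive y x l -> is_derive z x l.
Proof.
intros E Hx; apply is_derive_ext_loc.
exact (filter_imp _ _ E (open_I x Hx)).
Qed.

Lemma Dop_ext_on (y z : R -> V) (x : R) :
  (forall t, I t -> y t = z t) -> I x -> ex_derive y x -> Dop z x = Dop y x.
Proof.
intros E Hx Hy; apply Dop_unique, (is_derive_ext_on y); auto.
now apply Dop_correct.
Qed.

Lemma derivable_on_S (k : nat) (y : R -> V) :
  derivable_on I (S k) y <->
  (forall x, I x -> ex_derive y x) /\ derivable_on I k (Dop y).
Proof.
unfold derivable_on, op_pow; split.
- intros H; split.
  + intros x Hx; exact (H O x (Nat.lt_0_succ k) Hx).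
  + intros j x Hj Hx.
    rewrite <- Nat.iter_succ_r; apply H; [lia|exact Hx].
- intros [H0 H] [|j] x Hj Hx; [now apply H0|].
  rewrite Nat.iter_succ_r; apply H; [lia|exact Hx].
Qed.

Lemma derivable_on_O (y : R -> V) : derivable_on I 0 y.
Proof. intros j x Hj; lia. Qed.

Lemma derivable_on_le (k l : nat) (y : R -> V) :
  (k <= l)%nat -> derivable_on I l y -> derivable_on I k y.
Proof. intros Hkl H j x Hj; apply H; lia. Qed.

(** D is a local operator, so openness is what allows a function to be
    replaced by one that agrees with it on the set alone. *)
Lemma derivable_on_ext (k : nat) : forall y z : R -> V,
  (forall t, I t -> y t = z t) -> derivable_on I k y -> derivable_on I k z.
Proof.
induction k as [|k IH]; intros y z E H; [apply derivable_on_O|].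
apply derivable_on_S in H as [H0 H]; apply derivable_on_S; split.
- intros x Hx; destruct (H0 x Hx) as [l Hl].
  exists l; now apply (is_derive_ext_on y).
- apply (IH (Dop y)); [|exact H].
  intros t Ht; symmetry; apply Dop_ext_on; auto.
Qed.

Lemma derivable_on_step (k : nat) (y y1 : R -> V) :
  (forall x, I x -> is_derive y x (y1 x)) ->
  derivable_on I k y1 -> derivable_on I (S k) y.
Proof.
intros Hy H; apply derivable_on_S; split.
- intros x Hx; exists (y1 x); auto.
- apply (derivable_on_ext _ y1); [|exact H].
  intros t Ht; symmetry; now apply Dop_unique, Hy.
Qed.

Lemma derivable_on_const (k : nat) : forall c : V, derivable_on I k (fun _ => c).
Proof.
induction k as [|k IH]; intros c; [apply derivable_on_O|].
apply (derivable_on_step _ _ (fun _ => zero)); [|apply IH].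
intros x _; apply (is_derive_const c).
Qed.

Lemma derivable_on_plus (k : nat) : forall y z : R -> V,
  derivable_on I k y -> derivable_on I k z ->
  derivable_on I k (fun t => plus (y t) (z t)).
Proof.
induction k as [|k IH]; intros y z Hy Hz; [apply derivable_on_O|].
apply derivable_on_S in Hy as [Hy0 Hy]; apply derivable_on_S in Hz as [Hz0 Hz].
apply (derivable_on_step _ _ (fun t => plus (Dop y t) (Dop z t)));
  [|now apply IH].
intros x Hx; apply (is_derive_plus y z); apply Dop_correct; auto.
Qed.

(** A solution can be exhibited with its derivative in closed form, without
    mentioning the total derivative operator. *)
Lemma solution_intro (q : R -> R) (y y1 : R -> V) :
  (forall x, I x -> is_derive y x (y1 x)) ->
  (forall x, I x -> is_derive y1 x (scal (q x) (y x))) ->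
  solution I (schrodinger_op q) y.
Proof.
intros H0 H1; split.
- apply (derivable_on_step _ _ y1); [exact H0|].
  apply (derivable_on_step _ _ (fun t => scal (q t) (y t))); [exact H1|].
  apply derivable_on_O.
- intros x Hx.
  unfold schrodinger_op, op_minus, op_fun, op_pow; simpl.
  rewrite (Dop_ext_on y1 (Dop y) x).
  + rewrite (Dop_unique _ _ _ (H1 x Hx)). apply (plus_opp_r (G := V)).
  + intros t Ht; symmetry; now apply Dop_unique, H0.
  + exact Hx.
  + eexists; exact (H1 x Hx).
Qed.

Lemma solution_derive (q : R -> R) (y : R -> V) (x : R) :
  solution I (schrodinger_op q) y -> I x ->
  is_derive y x (Dop y x) /\ is_derive (Dop y) x (scal (q x) (y x)).
Proof.
intros [Hd H] Hx; split.
- apply Dop_correct; exact (Hd O x (Nat.lt_0_succ 1) Hx).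
- assert (E : op_pow Dop 2 y x = scal (q x) (y x)).
  { apply (plus_reg_r (opp (scal (q x) (y x)))).
    rewrite (plus_opp_r (G := V)); exact (H x Hx). }
  rewrite <- E; apply Dop_correct; exact (Hd 1%nat x (Nat.lt_succ_diag_r 1) Hx).
Qed.

Lemma solution_ext (q q' : R -> R) (y y' : R -> V) :
  (forall x, I x -> q x = q' x) -> (forall x, I x -> y x = y' x) ->
  solution I (schrodinger_op q) y -> solution I (schrodinger_op q') y'.
Proof.
intros Eq Ey H; apply (solution_intro _ _ (Dop y)); intros x Hx;
  destruct (solution_derive _ _ x H Hx) as [H0 H1].
- now apply (is_derive_ext_on y).
- now rewrite <- Eq, <- Ey.
Qed.

End Calculus.

Lemma derivable_on_scal {V : CompleteNormedModule R_AbsRing}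
  (I : R -> Prop) (open_I : open I) (k : nat) :
  forall (g : R -> R) (y : R -> V),
  derivable_on (V := R_CompleteNormedModule) I k g -> derivable_on I k y ->
  derivable_on I k (fun t => scal (g t) (y t)).
Proof.
induction k as [|k IH]; intros g y Hg Hy; [apply derivable_on_O|].
assert (Hg' := derivable_on_le _ k _ _ (Nat.le_succ_diag_r k) Hg).
assert (Hy' := derivable_on_le _ k _ _ (Nat.le_succ_diag_r k) Hy).
apply derivable_on_S in Hg as [Hg0 Hg]; apply derivable_on_S in Hy as [Hy0 Hy].
apply (derivable_on_step _ open_I _ _
         (fun t => plus (scal (Dop (V := R_CompleteNormedModule) g t) (y t))
                        (scal (g t) (Dop y t)))).
- intros x Hx; apply is_derive_scal_fun.
  + apply (Dop_correct (V := R_CompleteNormedModule) g x); auto.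
  + apply Dop_correct; auto.
- apply (derivable_on_plus _ open_I); apply IH; auto.
Qed.

Lemma solution_op_ext {V : CompleteNormedModule R_AbsRing} (I : R -> Prop)
  (L L' : (R -> V) -> (R -> V)) (y : R -> V) :
  (forall z x, I x -> L z x = L' z x) -> solution I L y -> solution I L' y.
Proof.
intros E [Hd H]; split; [exact Hd|].
intros x Hx; rewrite <- E; auto.
Qed.

Lemma general_solution_op_ext {V : CompleteNormedModule R_AbsRing}
  (I : R -> Prop) (L L' : (R -> V) -> (R -> V)) (Y : V -> V -> R -> V) :
  (forall z x, I x -> L z x = L' z x) ->
  general_solution I L Y -> general_solution I L' Y.
Proof.
intros E [H C]; split.
- intros c1 c2; exact (solution_op_ext I L L' _ E (H c1 c2)).
- intros y Hy; apply C; revert Hy; apply solution_op_ext.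
  intros z x Hx; symmetry; auto.
Qed.

(** The second derivative is a multiple of the function itself, so each order of
    differentiability gives two more; two consecutive orders are carried along. *)
Lemma derivable_on_solution_const {V : CompleteNormedModule R_AbsRing}
  (I : R -> Prop) (lam : R) (y : R -> V) (k : nat) :
  open I -> solution I (schrodinger_op (fun _ => lam)) y -> derivable_on I k y.
Proof.
intros open_I Hy.
enough (H : derivable_on I k y /\ derivable_on I (S k) y) by apply H.
induction k as [|k [IH0 IH1]].
- split; [apply derivable_on_O|].
  exact (derivable_on_le _ 1 2 _ (Nat.le_succ_diag_r 1) (proj1 Hy)).
- split; [exact IH1|].
  apply (derivable_on_step _ open_I _ _ (Dop y));
    [intros x Hx; apply (solution_derive _ _ _ _ Hy Hx)|].
  apply (derivable_on_step _ open_I _ _ (fun x => scal lam (y x)));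
    [intros x Hx; apply (solution_derive _ _ _ _ Hy Hx)|].
  apply (derivable_on_scal _ open_I _ (fun _ => lam)); [|exact IH0].
  apply (derivable_on_const _ open_I).
Qed.

(** On an empty interval any constant will do; hence the case distinction. *)
Lemma zero_derivative_const {V : CompleteNormedModule R_AbsRing}
  (al be : Rbar) (y : R -> V) :
  (forall x, Rbar_interval al be x -> is_derive y x zero) ->
  exists c, forall x, Rbar_interval al be x -> y x = c.
Proof.
intros H.
destruct (classic (exists x, Rbar_interval al be x)) as [[x0 H0]|He].
2: { exists zero; intros x Hx; destruct He; now exists x. }
assert (Hlt : forall u v, u < v -> Rbar_interval al be u ->
                Rbar_interval al be v -> y u = y v).
{ intros u v Huv [Hu _] [_ Hv]; apply eq_is_derive; [|exact Huv].
  intros t [Hut Htv]; apply H; split.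
  - now apply (Rbar_lt_le_trans _ u).
  - now apply (Rbar_le_lt_trans _ v). }
exists (y x0); intros x Hx.
destruct (Rtotal_order x x0) as [Hlx|[->|Hlx]]; [|reflexivity|symmetry]; auto.
Qed.

Lemma Rbar_interval_open (al be : Rbar) : open (Rbar_interval al be).
Proof. apply open_and; [apply open_Rbar_gt|apply open_Rbar_lt]. Qed.

(** * Ladder operators *)

Section Ladder.

Context {V : CompleteNormedModule R_AbsRing} (I : R -> Prop) (open_I : open I).
Context (m : R) (r : R -> R)
  (riccati : forall x, I x -> is_derive r x (- m * (r x ^ 2 + 1))).

Definition ladder (kappa : R) : (R -> V) -> (R -> V) :=
  op_minus Dop (op_fun (fun t => kappa * m * r t)).

Definition ladder_potential (lam c x : R) : R := lam + c * (m ^ 2 * (r x ^ 2 + 1)).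

Lemma is_derive_ladder_coef (kappa x : R) :
  I x -> is_derive (fun t => kappa * m * r t) x
           (- (kappa * m ^ 2 * (r x ^ 2 + 1))).
Proof.
intros Hx; auto_derive.
- eexists; exact (riccati x Hx).
- replace (Derive (fun x0 => r x0) x) with (- m * (r x ^ 2 + 1));
    [ring | symmetry; exact (is_derive_unique _ _ _ (riccati x Hx))].
Qed.

Lemma is_derive_ladder (kappa : R) (y : R -> V) (x : R) (y2 : V) :
  I x -> is_derive y x (Dop y x) -> is_derive (Dop y) x y2 ->
  is_derive (ladder kappa y) x
    (minus y2 (plus (scal (- (kappa * m ^ 2 * (r x ^ 2 + 1))) (y x))
                    (scal (kappa * m * r x) (Dop y x)))).
Proof.
intros Hx H0 H1; apply (is_derive_minus (Dop y)); [exact H1|].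
apply (is_derive_scal_fun (fun t => kappa * m * r t) y);
  [now apply is_derive_ladder_coef|exact H0].
Qed.

Lemma ladder_ext (kappa : R) (y z : R -> V) (x : R) :
  (forall t, I t -> y t = z t) -> I x -> ex_derive y x ->
  ladder kappa z x = ladder kappa y x.
Proof.
intros E Hx Hy; unfold ladder, op_minus, op_fun.
now rewrite (Dop_ext_on I open_I y z), E.
Qed.

(** The Riccati equation absorbs the derivative of the coefficient kappa m r, and
    the first-order terms cancel because the two coefficients are opposite. *)
Lemma ladder_factor (kappa : R) (y : R -> V) (x : R) :
  derivable_on I 2 y -> I x ->
  ladder (- kappa) (ladder kappa y) x
  = minus (Dop (Dop y) x)
      (scal (kappa * (kappa - 1) * (m ^ 2 * (r x ^ 2 + 1)) - m ^ 2 * kappa ^ 2)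
            (y x)).
Proof.
intros H Hx.
assert (H0 : is_derive y x (Dop y x)).
{ apply Dop_correct; exact (H O x (Nat.lt_0_succ 1) Hx). }
assert (H1 : is_derive (Dop y) x (Dop (Dop y) x)).
{ apply Dop_correct; exact (H 1%nat x (Nat.lt_succ_diag_r 1) Hx). }
unfold ladder at 1; unfold op_minus at 1; unfold op_fun at 1.
rewrite (Dop_unique _ _ _ (is_derive_ladder kappa y x _ Hx H0 H1)).
unfold ladder, op_minus, op_fun.
generalize (Dop (Dop y) x) (Dop y x) (y x); intros y2 y1 y0.
unfold minus; rewrite <- (plus_assoc y2); f_equal.
vector_eq y0 y1; ring.
Qed.

(** With S = m^2 (r^2 + 1), S' = - 2 m r S.  For z = y' - kappa m r y the equation
    for y gives z' = (lam + kappa^2 S) y - kappa m r y', and one more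
    differentiation turns this into a multiple of z. *)
Lemma ladder_solution (lam kappa : R) (y : R -> V) :
  solution I (schrodinger_op (ladder_potential lam (kappa * (kappa - 1)))) y ->
  solution I (schrodinger_op (ladder_potential lam (kappa * (kappa + 1))))
    (ladder kappa y).
Proof.
intros Hy.
apply (solution_intro _ open_I _ _ (fun x =>
         minus (scal (lam + kappa ^ 2 * m ^ 2 * (r x ^ 2 + 1)) (y x))
               (scal (kappa * m * r x) (Dop y x))));
  intros x Hx; destruct (solution_derive _ _ _ x Hy Hx) as [H0 H1].
- eapply eq_rect; [exact (is_derive_ladder kappa y x _ Hx H0 H1)|].
  unfold ladder_potential; vector_eq (y x) (Dop y x); ring.
- assert (Hc : is_derive (fun t => lam + kappa ^ 2 * m ^ 2 * (r t ^ 2 + 1)) x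
                 (- (2 * kappa ^ 2 * m ^ 3 * r x * (r x ^ 2 + 1)))).
  { auto_derive.
    - eexists; exact (riccati x Hx).
    - replace (Derive (fun x0 => r x0) x) with (- m * (r x ^ 2 + 1));
        [ring | symmetry; exact (is_derive_unique _ _ _ (riccati x Hx))]. }
  eapply eq_rect.
  + apply (is_derive_minus (fun t => scal _ (y t)) (fun t => scal _ (Dop y t))).
    * exact (is_derive_scal_fun _ _ _ _ _ Hc H0).
    * exact (is_derive_scal_fun _ _ _ _ _
               (is_derive_ladder_coef kappa x Hx) H1).
  + unfold ladder_potential, ladder, op_minus, op_fun.
    vector_eq (y x) (Dop y x); ring.
Qed.

(** On the kernel of a Schroedinger operator the product of the two opposite
    ladder operators is scalar; when the scalar is nonzero the descent is an
    inverse of the ascent, up to normalization. *)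
Lemma ladder_lower (lam kappa : R) (y : R -> V) (x : R) :
  solution I (schrodinger_op (ladder_potential lam (kappa * (kappa - 1)))) y ->
  I x ->
  ladder (- kappa) (ladder kappa y) x = scal (lam + m ^ 2 * kappa ^ 2) (y x).
Proof.
intros Hy Hx; rewrite (ladder_factor _ _ _ (proj1 Hy) Hx).
destruct (solution_derive _ _ _ x Hy Hx) as [_ H1].
rewrite (Dop_unique _ _ _ H1); unfold ladder_potential.
vector_eq (y x) (y x); ring.
Qed.

Lemma solution_scal (q : R -> R) (c : R) (y : R -> V) :
  solution I (schrodinger_op q) y ->
  solution I (schrodinger_op q) (fun x => scal c (y x)).
Proof.
intros Hy; apply (solution_intro _ open_I _ _ (fun x => scal c (Dop y x)));
  intros x Hx; destruct (solution_derive _ _ _ x Hy Hx) as [H0 H1].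
- exact (is_derive_const_scal c y x _ H0).
- eapply eq_rect; [exact (is_derive_const_scal c (Dop y) x _ H1)|].
  vector_eq (y x) (y x); ring.
Qed.

(** The preimage of z is a multiple of D z + kappa m r z.  Replacing kappa by
    - kappa exchanges kappa (kappa - 1) and kappa (kappa + 1), so the facts proved
    for the ascent also give the descent. *)
Lemma ladder_surjective (lam kappa : R) (z : R -> V) :
  lam + m ^ 2 * kappa ^ 2 <> 0 ->
  solution I (schrodinger_op (ladder_potential lam (kappa * (kappa + 1)))) z ->
  exists y : R -> V,
    solution I (schrodinger_op (ladder_potential lam (kappa * (kappa - 1)))) y /\
    forall x, I x -> z x = ladder kappa y x.
Proof.
intros Hk Hz.
set (c := / (lam + m ^ 2 * kappa ^ 2)).
assert (Hz' : solution I (schrodinger_op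
                (ladder_potential lam (- kappa * (- kappa - 1)))) z).
{ revert Hz; apply (solution_ext _ open_I); [|reflexivity].
  intros x _; f_equal; ring. }
assert (Hw := ladder_solution lam (- kappa) z Hz').
exists (fun x => scal c (ladder (- kappa) z x)); split.
- apply solution_scal; revert Hw; apply (solution_ext _ open_I); [|reflexivity].
  intros x _; f_equal; ring.
- intros x Hx.
  assert (E := ladder_lower lam (- kappa) z x Hz' Hx).
  rewrite Ropp_involutive in E.
  destruct (solution_derive _ _ _ x Hw Hx) as [H0 _].
  assert (E' : ladder kappa (fun t => scal c (ladder (- kappa) z t)) x
               = scal c (ladder kappa (ladder (- kappa) z) x)).
  { clear E; revert H0; generalize (ladder (- kappa) z); intros w H0.
    unfold ladder, op_minus, op_fun.
    rewrite (Dop_unique _ _ _ (is_derive_const_scal c w x _ H0)).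
    vector_eq (Dop w x) (w x); ring. }
  rewrite E', E; vector_eq (z x) (z x); [unfold c; field|ring].
  intros F; apply Hk; rewrite <- F; ring.
Qed.

Definition ladder_product (n : nat) : (R -> V) -> (R -> V) :=
  op_prod (fun k => ladder (INR k)) n.

Lemma ladder_product_solution (lam : R) (n : nat) (y : R -> V) :
  solution I (schrodinger_op (fun _ => lam)) y ->
  solution I (schrodinger_op (ladder_potential lam (INR n * (INR n + 1))))
    (ladder_product n y).
Proof.
intros Hy; induction n as [|n IH]; apply ladder_solution.
- revert Hy; apply (solution_ext _ open_I); [|reflexivity].
  intros x _; unfold ladder_potential; simpl; ring.
- revert IH; apply (solution_ext _ open_I); [|reflexivity].
  intros x _; f_equal; rewrite S_INR; ring.
Qed.

Lemma ladder_product_ext (lam : R) (n : nat) (y z : R -> V) :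
  solution I (schrodinger_op (fun _ => lam)) y ->
  (forall x, I x -> y x = z x) ->
  forall x, I x -> ladder_product n y x = ladder_product n z x.
Proof.
intros Hy E; induction n as [|n IH]; intros x Hx; symmetry; apply ladder_ext;
  try assumption.
- exact (proj1 Hy O x (Nat.lt_0_succ 1) Hx).
- exact (proj1 (ladder_product_solution lam n y Hy) O x (Nat.lt_0_succ 1) Hx).
Qed.

(** The condition includes k = 0, where it says that lam is nonzero: the first
    factor D is inverted on the solutions of y'' = lam y by D / lam. *)
Lemma ladder_product_surjective (lam : R) (n : nat) : forall z : R -> V,
  (forall k, (k <= n)%nat -> lam + m ^ 2 * INR k ^ 2 <> 0) ->
  solution I (schrodinger_op (ladder_potential lam (INR n * (INR n + 1)))) z ->
  exists y : R -> V, solution I (schrodinger_op (fun _ => lam)) y /\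
    forall x, I x -> z x = ladder_product n y x.
Proof.
induction n as [|n IH]; intros z Hk Hz;
  destruct (ladder_surjective lam _ z (Hk _ (le_n _)) Hz) as [y [Hy E]].
- exists y; split; [|exact E].
  revert Hy; apply (solution_ext _ open_I); [|reflexivity].
  intros x _; unfold ladder_potential; simpl; ring.
- destruct (IH y) as [y0 [Hy0 E0]].
  + intros k Hkn; apply Hk; lia.
  + revert Hy; apply (solution_ext _ open_I); [|reflexivity].
    intros x _; f_equal; rewrite S_INR; ring.
  + exists y0; split; [exact Hy0|].
    intros x Hx; rewrite (E x Hx); symmetry.
    apply (ladder_ext _ y); [exact E0|exact Hx|].
    exact (proj1 Hy O x (Nat.lt_0_succ 1) Hx).
Qed.

Section Prefactor.

Context (f : R -> R) (f_neq_0 : forall x, I x -> f x <> 0)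
  (f_log_derivative : forall x, I x -> is_derive f x (m * r x * f x)).

(** The Riccati equation expresses r' polynomially in r, so one more derivative
    always exists. *)
Lemma derivable_on_r (k : nat) :
  derivable_on (V := R_CompleteNormedModule) I k r.
Proof.
induction k as [|k IH]; [apply derivable_on_O|].
apply (derivable_on_step _ open_I _ _ _ riccati).
apply (derivable_on_ext _ open_I _ (fun t =>
  plus (- m : R_CompleteNormedModule)
       (scal (- m) (scal (r t) (r t : R_CompleteNormedModule))))).
- intros t _; change (- m + - m * (r t * r t) = - m * (r t ^ 2 + 1)); ring.
- apply (derivable_on_plus _ open_I); [apply (derivable_on_const _ open_I)|].
  apply (derivable_on_scal _ open_I); [apply (derivable_on_const _ open_I)|].
  now apply (derivable_on_scal _ open_I).
Qed.

Lemma derivable_on_inv_f (k : nat) :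
  derivable_on (V := R_CompleteNormedModule) I k (fun t => 1 / f t).
Proof.
induction k as [|k IH]; [apply derivable_on_O|].
apply (derivable_on_step _ open_I _ _ (fun t =>
  scal (- m) (scal (r t) (1 / f t : R_CompleteNormedModule)))).
- intros x Hx.
  change (is_derive (fun t => 1 / f t) x (- m * (r x * (1 / f x)))).
  assert (H := f_neq_0 x Hx).
  auto_derive; [split; [eexists; exact (f_log_derivative x Hx)|now split]|].
  replace (Derive (fun x0 => f x0) x) with (m * r x * f x);
    [field; exact H
    |symmetry; exact (is_derive_unique _ _ _ (f_log_derivative x Hx))].
- apply (derivable_on_scal _ open_I); [apply (derivable_on_const _ open_I)|].
  apply (derivable_on_scal _ open_I); [apply derivable_on_r|exact IH].
Qed.

Lemma is_derive_f_pow (N : nat) (x : R) :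
  I x -> is_derive (fun t => f t ^ N) x (INR N * m * r x * f x ^ N).
Proof.
intros Hx.
assert (E : INR N * m * r x * f x ^ N
            = INR N * (m * r x * f x) * f x ^ Nat.pred N).
{ destruct N as [|N]; cbn [pow Nat.pred]; [simpl|]; ring. }
rewrite E; exact (is_derive_pow f N x _ (f_log_derivative x Hx)).
Qed.

Definition scaled_D : (R -> V) -> (R -> V) :=
  op_comp (op_fun (fun t => 1 / f t)) Dop.

Lemma derivable_on_scaled_D_pow (k j : nat) : forall y : R -> V,
  derivable_on I (k + j) y -> derivable_on I k (op_pow scaled_D j y).
Proof.
revert k; induction j as [|j IH]; intros k y Hy.
- now rewrite Nat.add_0_r in Hy.
- rewrite Nat.add_succ_r in Hy; apply (IH (S k)), derivable_on_S in Hy.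
  apply (derivable_on_scal _ open_I); [apply derivable_on_inv_f|exact (proj2 Hy)].
Qed.

(** If the first n + 1 factors give f^(n+1) z, the next one gives
    D (f^(n+1) z) - (n + 1) m r f^(n+1) z = f^(n+1) z' = f^(n+2) (1/f) z'. *)
Lemma ladder_product_eq (n : nat) (y : R -> V) :
  derivable_on I (n + 1) y -> forall x, I x ->
  ladder_product n y x = scal (f x ^ (n + 1)) (op_pow scaled_D (n + 1) y x).
Proof.
rewrite Nat.add_1_r.
induction n as [|n IH]; intros Hy x Hx.
- change (minus (Dop y x) (scal (0 * m * r x) (y x))
          = scal (f x ^ 1) (scal (1 / f x) (Dop y x))).
  vector_eq (Dop y x) (y x); [field; auto|ring].
- assert (E := IH (derivable_on_le _ _ _ _ (Nat.le_succ_diag_r _) Hy)).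
  set (z := op_pow scaled_D (S n) y) in *.
  assert (Hz : is_derive z x (Dop z x)).
  { apply Dop_correct.
    apply (derivable_on_scaled_D_pow 1 (S n) y Hy 0%nat x Nat.lt_0_1 Hx). }
  assert (H := is_derive_scal_fun _ _ _ _ _ (is_derive_f_pow (S n) x Hx) Hz).
  change (ladder (INR (S n)) (ladder_product n y) x
          = scal (f x ^ S (S n)) (scal (1 / f x) (Dop z x))).
  rewrite (ladder_ext _ (fun t => scal (f t ^ S n) (z t))).
  + unfold ladder, op_minus, op_fun; rewrite (Dop_unique _ _ _ H).
    rewrite <- (tech_pow_Rmult (f x) (S n)).
    vector_eq (z x) (Dop z x); [ring|field; auto].
  + intros t Ht; symmetry; now apply E.
  + exact Hx.
  + eexists; exact H.
Qed.

End Prefactor.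

End Ladder.

(** * The resonant case *)

(** Let u be the image of a solution y under the first-order operator
    D - N m r.  It satisfies u' = - N m r u, so f^N u is a constant c2; then
    (f^(-N) y)' = f^(-N) u = c2 f^(-2 N), so f^(-N) y - c2 G is a constant c1. *)
Lemma general_solution_resonant {V : CompleteNormedModule R_AbsRing}
  (al be : Rbar) (m : R) (r f G : R -> R) (N : nat) :
  let I := Rbar_interval al be in
  (forall x, I x -> is_derive r x (- m * (r x ^ 2 + 1))) ->
  (forall x, I x -> f x <> 0) ->
  (forall x, I x -> is_derive f x (m * r x * f x)) ->
  (forall x, I x -> is_derive G x (/ f x ^ (2 * N))) ->
  general_solution I
    (schrodinger_op (ladder_potential m r (- (m ^ 2 * INR N ^ 2))
                       (INR N * (INR N - 1))))
    (fun (c1 c2 : V) x => scal (f x ^ N) (plus c1 (scal (G x) c2))).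
Proof.
intros I riccati f_neq_0 Hf HG.
assert (open_I : open I) by apply Rbar_interval_open.
assert (HG' : forall x, I x -> is_derive G x (/ (f x ^ N * f x ^ N))).
{ intros x Hx; rewrite <- pow_add.
  replace (N + N)%nat with (2 * N)%nat by lia; now apply HG. }
assert (fN_neq_0 : forall x, I x -> f x ^ N <> 0).
{ intros x Hx; apply pow_nonzero; auto. }
assert (HfN : forall x, I x ->
          is_derive (fun t => f t ^ N) x (INR N * m * r x * f x ^ N)).
{ exact (is_derive_f_pow I m r f Hf N). }
assert (HfVN : forall x, I x ->
          is_derive (fun t => / f t ^ N) x (- (INR N * m * r x) * / f x ^ N)).
{ intros x Hx.
  replace (- (INR N * m * r x) * / f x ^ N)
    with (- (INR N * m * r x * f x ^ N) / (f x ^ N) ^ 2) by (field; auto).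
  exact (is_derive_inv (fun t => f t ^ N) x _ (HfN x Hx) (fN_neq_0 x Hx)). }
split.
- intros c1 c2.
  apply (solution_intro _ open_I _ _ (fun x =>
    plus (scal (f x ^ N) (scal (INR N * m * r x) (plus c1 (scal (G x) c2))))
         (scal (/ f x ^ N) c2))); intros x Hx;
  assert (HC : is_derive (fun t => plus c1 (scal (G t) c2)) x
                 (plus zero (scal (/ (f x ^ N * f x ^ N)) c2)))
    by (apply (is_derive_plus (fun _ => c1) (fun t => scal (G t) c2));
        [exact (is_derive_const c1 x)
        |exact (is_derive_scal_l G x _ c2 (HG' x Hx))]).
  + eapply eq_rect; [exact (is_derive_scal_fun _ _ _ _ _ (HfN x Hx) HC)|].
    vector_eq c1 c2; [ring|field; auto].
  + eapply eq_rect.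
    * apply (is_derive_plus
               (fun t => scal (f t ^ N)
                  (scal (INR N * m * r t) (plus c1 (scal (G t) c2))))
               (fun t => scal (/ f t ^ N) c2)).
      -- exact (is_derive_scal_fun _ _ _ _ _ (HfN x Hx)
                  (is_derive_scal_fun _ _ _ _ _
                     (is_derive_ladder_coef I m r riccati (INR N) x Hx) HC)).
      -- exact (is_derive_scal_l (fun t => / f t ^ N) x _ c2 (HfVN x Hx)).
    * unfold ladder_potential; vector_eq c1 c2; [ring|field; auto].
- intros y Hy.
  set (u := ladder m r (INR N) y).
  assert (Hu : forall x, I x ->
            is_derive u x (scal (- (INR N * m * r x)) (u x))).
  { intros x Hx; destruct (solution_derive _ _ _ x Hy Hx) as [H0 H1].
    assert (Du := is_derive_ladder I m r riccati (INR N) y x _ Hx H0 H1).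
    fold u in Du.
    assert (E := ladder_lower I m r riccati _ _ y x Hy Hx).
    fold u in E; unfold ladder, op_minus, op_fun in E.
    (* The scalar of [ladder_lower] vanishes here, so D u + N m r u = 0. *)
    assert (E' : Dop u x = scal (- (INR N * m * r x)) (u x)).
    { apply (plus_reg_r (opp (scal (- INR N * m * r x) (u x)))).
      eapply eq_trans; [exact E|].
      vector_eq (y x) (u x); ring. }
    rewrite <- E'; apply Dop_correct; eexists; exact Du. }
  destruct (zero_derivative_const al be (fun x => scal (f x ^ N) (u x)))
    as [c2 Hc2].
  { intros x Hx; eapply eq_rect;
      [exact (is_derive_scal_fun _ _ _ _ _ (HfN x Hx) (Hu x Hx))|].
    vector_eq (u x) (u x); ring. }
  destruct (zero_derivative_const al be
              (fun x => minus (scal (/ f x ^ N) (y x)) (scal (G x) c2)))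
    as [c1 Hc1].
  { intros x Hx; destruct (solution_derive _ _ _ x Hy Hx) as [H0 _].
    eapply eq_rect.
    - apply (is_derive_minus (fun t => scal (/ f t ^ N) (y t))
               (fun t => scal (G t) c2)).
      + exact (is_derive_scal_fun _ _ _ _ _ (HfVN x Hx) H0).
      + exact (is_derive_scal_l G x _ c2 (HG' x Hx)).
    - rewrite <- (Hc2 x Hx); unfold u, ladder, op_minus, op_fun.
      vector_eq (y x) (Dop y x); field; auto. }
  exists c1, c2; intros x Hx; rewrite <- (Hc1 x Hx).
  vector_eq (y x) c2; field; auto.
Qed.

(** * The equation with constant coefficients *)

(** For any solution y the Wronskians of y with u and with v are constant, and
    Cramer's rule recovers y from them. *)
Lemma general_solution_wronskian {V : CompleteNormedModule R_AbsRing}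
  (al be : Rbar) (q u v u1 v1 : R -> R) (W : R) :
  (forall x, is_derive u x (u1 x)) -> (forall x, is_derive u1 x (q x * u x)) ->
  (forall x, is_derive v x (v1 x)) -> (forall x, is_derive v1 x (q x * v x)) ->
  W <> 0 -> (forall x, u x * v1 x - u1 x * v x = W) ->
  general_solution (Rbar_interval al be) (schrodinger_op q)
    (fun (c1 c2 : V) x => plus (scal (u x) c1) (scal (v x) c2)).
Proof.
intros Hu Hu1 Hv Hv1 HW EW.
assert (open_I := Rbar_interval_open al be); split.
- intros c1 c2.
  apply (solution_intro _ open_I _ _
           (fun x => plus (scal (u1 x) c1) (scal (v1 x) c2))); intros x _.
  + apply (is_derive_plus (fun t => scal (u t) c1) (fun t => scal (v t) c2));
      [exact (is_derive_scal_l u x _ c1 (Hu x))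
      |exact (is_derive_scal_l v x _ c2 (Hv x))].
  + eapply eq_rect;
      [apply (is_derive_plus (fun t => scal (u1 t) c1) (fun t => scal (v1 t) c2));
       [exact (is_derive_scal_l u1 x _ c1 (Hu1 x))
       |exact (is_derive_scal_l v1 x _ c2 (Hv1 x))]|].
    vector_eq c1 c2; ring.
- intros y Hy.
  assert (Hconst : forall (g g1 : R -> R), (forall x, is_derive g x (g1 x)) ->
            (forall x, is_derive g1 x (q x * g x)) ->
            exists c, forall x, Rbar_interval al be x ->
              minus (scal (g1 x) (y x)) (scal (g x) (Dop y x)) = c).
  { intros g g1 Hg Hg1; apply zero_derivative_const; intros x Hx.
    destruct (solution_derive _ _ _ x Hy Hx) as [H0 H1].
    eapply eq_rect;
      [apply (is_derive_minus (fun t => scal (g1 t) (y t))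
                (fun t => scal (g t) (Dop y t)));
       [exact (is_derive_scal_fun _ _ _ _ _ (Hg1 x) H0)
       |exact (is_derive_scal_fun _ _ _ _ _ (Hg x) H1)]|].
    vector_eq (y x) (Dop y x); ring. }
  destruct (Hconst v v1 Hv Hv1) as [c Hc].
  destruct (Hconst u u1 Hu Hu1) as [d Hd].
  exists (scal (/ W) c), (scal (- / W) d); intros x Hx.
  rewrite <- (Hc x Hx), <- (Hd x Hx).
  assert (E := EW x).
  vector_eq (y x) (Dop y x); [|ring].
  transitivity (/ W * (u x * v1 x - u1 x * v x)); [|ring].
  rewrite E; now field.
Qed.

Lemma general_solution_reparam {V : CompleteNormedModule R_AbsRing}
  (I : R -> Prop) (q : R -> R) (Y Z : V -> V -> R -> V) :
  open I -> general_solution I (schrodinger_op q) Z ->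
  (forall c1 c2, exists d1 d2, forall x, Y c1 c2 x = Z d1 d2 x) ->
  (forall d1 d2, exists c1 c2, forall x, Y c1 c2 x = Z d1 d2 x) ->
  general_solution I (schrodinger_op q) Y.
Proof.
intros open_I [HZ CZ] HY CY; split.
- intros c1 c2; destruct (HY c1 c2) as [d1 [d2 E]].
  now apply (solution_ext _ open_I q q (Z d1 d2)).
- intros y Hy; destruct (CZ y Hy) as [d1 [d2 E]].
  destruct (CY d1 d2) as [c1 [c2 E']].
  exists c1, c2; intros x Hx; now rewrite E', E.
Qed.

Section ConstantCoefficients.

Context {V : CompleteNormedModule R_AbsRing} (al be : Rbar).

Let I := Rbar_interval al be.

Lemma general_solution_exp (lam : R) : 0 < lam ->
  general_solution I (schrodinger_op (fun _ => lam))
    (fun (c1 c2 : V) x => plus (scal (exp (sqrt lam * x)) c1)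
                               (scal (exp (- sqrt lam * x)) c2)).
Proof.
intros Hlam; assert (Hs := sqrt_lt_R0 lam Hlam).
assert (E := sqrt_def lam (Rlt_le _ _ Hlam)).
revert Hs E; generalize (sqrt lam); intros s Hs E.
apply (general_solution_wronskian al be _ _ _
         (fun x => s * exp (s * x)) (fun x => - s * exp (- s * x)) (- 2 * s)).
1-4: intros x; rewrite <- ?E; auto_derive; [easy|ring].
- lra.
- intros x.
  replace (- s * x) with (- (s * x)) by ring; rewrite exp_Ropp.
  field; apply Rgt_not_eq, exp_pos.
Qed.

Lemma general_solution_hyperbolic (lam : R) : 0 < lam ->
  general_solution I (schrodinger_op (fun _ => lam))
    (fun (c1 c2 : V) x => plus (scal (cosh (sqrt lam * x)) c1)
                               (scal (sinh (sqrt lam * x)) c2)).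
Proof.
intros Hlam; assert (Hs := sqrt_lt_R0 lam Hlam).
assert (E := sqrt_def lam (Rlt_le _ _ Hlam)).
revert Hs E; generalize (sqrt lam); intros s Hs E.
apply (general_solution_wronskian al be _ _ _
         (fun x => s * sinh (s * x)) (fun x => s * cosh (s * x)) s).
1-4: intros x; rewrite <- ?E; unfold cosh, sinh; auto_derive; [easy|field].
- lra.
- intros x; unfold cosh, sinh; rewrite exp_Ropp.
  field; apply Rgt_not_eq, exp_pos.
Qed.

Lemma general_solution_trigonometric (lam : R) : lam < 0 ->
  general_solution I (schrodinger_op (fun _ => lam))
    (fun (c1 c2 : V) x => plus (scal (cos (sqrt (- lam) * x)) c1)
                               (scal (sin (sqrt (- lam) * x)) c2)).
Proof.
intros Hlam; assert (Hs : 0 < sqrt (- lam)) by (apply sqrt_lt_R0; lra).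
assert (E : sqrt (- lam) * sqrt (- lam) = - lam) by (apply sqrt_def; lra).
revert Hs E; generalize (sqrt (- lam)); intros s Hs E.
replace lam with (- (s * s)) by lra.
apply (general_solution_wronskian al be _ _ _
         (fun x => - s * sin (s * x)) (fun x => s * cos (s * x)) s).
1-4: intros x; auto_derive; [easy|ring].
- lra.
- intros x; assert (P := sin2_cos2 (s * x)); unfold Rsqr in P.
  transitivity (s * (sin (s * x) * sin (s * x) + cos (s * x) * cos (s * x)));
    [ring|rewrite P; ring].
Qed.

End ConstantCoefficients.

Lemma cexp_csqrt_pos (lam x : R) : 0 < lam ->
  cexp (csqrt lam * x)%C = RtoC (exp (sqrt lam * x)) /\
  cexp (- csqrt lam * x)%C = RtoC (exp (- sqrt lam * x)).
Proof.
intros Hlam; unfold cexp, csqrt, RtoC; simpl.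
rewrite (sqrt_neg_0 (- lam)) by lra.
replace (sqrt lam * x - 0 * 0) with (sqrt lam * x) by ring.
replace (- sqrt lam * x - - 0 * 0) with (- sqrt lam * x) by ring.
replace (sqrt lam * 0 + 0 * x) with 0 by ring.
replace (- sqrt lam * 0 + - 0 * x) with 0 by ring.
rewrite cos_0, sin_0; split; f_equal; ring.
Qed.

Lemma cexp_csqrt_neg (lam x : R) : lam < 0 ->
  cexp (csqrt lam * x)%C = (cos (sqrt (- lam) * x), sin (sqrt (- lam) * x)) /\
  cexp (- csqrt lam * x)%C
  = (cos (sqrt (- lam) * x), - sin (sqrt (- lam) * x)).
Proof.
intros Hlam; unfold cexp, csqrt, RtoC; simpl.
rewrite (sqrt_neg_0 lam) by lra.
replace (0 * x - sqrt (- lam) * 0) with 0 by ring.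
replace (- 0 * x - - sqrt (- lam) * 0) with 0 by ring.
replace (0 * 0 + sqrt (- lam) * x) with (sqrt (- lam) * x) by ring.
replace (- 0 * 0 + - sqrt (- lam) * x) with (- (sqrt (- lam) * x)) by ring.
rewrite exp_0, cos_neg, sin_neg; split; f_equal; ring.
Qed.

(** For negative lam the complex exponential form is obtained from the
    trigonometric one by d1 = c1 + c2 and d2 = i (c1 - c2). *)
Lemma general_solution_y0 (al be : Rbar) (lam : R) (K : scalars)
  (Y0 : carrier K -> carrier K -> R -> carrier K) :
  lam <> 0 -> y0_form lam K Y0 ->
  general_solution (Rbar_interval al be) (schrodinger_op (fun _ => lam)) Y0.
Proof.
intros Hlam HY; assert (open_I := Rbar_interval_open al be).
destruct HY as [Hpos| |K Hpos|K Hneg].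
- apply (general_solution_reparam _ _ _ _ open_I
           (general_solution_exp al be lam Hpos));
    intros c1 c2; exists c1, c2; intros x;
    change (c1 * exp (sqrt lam * x) + c2 * exp (- sqrt lam * x)
            = exp (sqrt lam * x) * c1 + exp (- sqrt lam * x) * c2); ring.
- destruct (Rtotal_order lam 0) as [Hneg|[Hz|Hpos]]; [|easy|].
  + apply (general_solution_reparam _ _ _ _ open_I
             (general_solution_trigonometric al be lam Hneg)).
    * intros c1 c2; exists (c1 + c2)%C, (Ci * (c1 - c2))%C; intros x.
      destruct (cexp_csqrt_neg lam x Hneg) as [-> ->].
      destruct c1 as [p1 q1], c2 as [p2 q2].
      apply injective_projections; simpl; unfold scal, plus; simpl;
        unfold mult; simpl; ring.
    * intros d1 d2; exists ((d1 - Ci * d2) / 2)%C, ((d1 + Ci * d2) / 2)%C.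
      intros x; destruct (cexp_csqrt_neg lam x Hneg) as [-> ->].
      destruct d1 as [p1 q1], d2 as [p2 q2].
      apply injective_projections; simpl; unfold scal, plus; simpl;
        unfold mult; simpl; field.
  + apply (general_solution_reparam _ _ _ _ open_I
             (general_solution_exp al be lam Hpos));
      intros c1 c2; exists c1, c2; intros x;
      destruct (cexp_csqrt_pos lam x Hpos) as [-> ->];
      destruct c1 as [p1 q1], c2 as [p2 q2];
      apply injective_projections; simpl; unfold scal, plus; simpl;
        unfold mult; simpl; ring.
- now apply general_solution_hyperbolic.
- now apply general_solution_trigonometric.
Qed.

(** * Trigonometric ladders *)

Lemma trig_f_log_derivative (a b m x : R) :
  trig_f a b m x <> 0 ->
  is_derive (trig_f a b m) x (m * trig_r a b m x * trig_f a b m x).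
Proof.
intros Hx; unfold trig_r, trig_f in *; auto_derive; [easy|]; field; exact Hx.
Qed.

Lemma trig_r_sqr (a b m x : R) :
  trig_f a b m x <> 0 ->
  trig_r a b m x ^ 2 + 1 = (a ^ 2 + b ^ 2) / trig_f a b m x ^ 2.
Proof.
intros Hx; unfold trig_r, trig_f in *.
assert (P := sin2_cos2 (m * x)); unfold Rsqr in P.
transitivity ((a ^ 2 + b ^ 2) *
    (sin (m * x) * sin (m * x) + cos (m * x) * cos (m * x))
    / (a * cos (m * x) + b * sin (m * x)) ^ 2); [field; exact Hx|].
rewrite P; field; exact Hx.
Qed.

Lemma trig_r_riccati (a b m x : R) :
  trig_f a b m x <> 0 ->
  is_derive (trig_r a b m) x (- m * (trig_r a b m x ^ 2 + 1)).
Proof.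
intros Hx; unfold trig_r, trig_f in *; auto_derive; [easy|]; field; exact Hx.
Qed.

Theorem mainTheorem5 (n : nat) (hn : (1 <= n)%nat) (a b m : R) (al be : Rbar)
  (hf : forall x, Rbar_interval al be x -> trig_f a b m x <> 0)
  (K : scalars) :
  let I := Rbar_interval al be in
  let f := trig_f a b m in
  let r := trig_r a b m in
  let T : (R -> carrier K) -> (R -> carrier K) :=
    op_comp (op_fun (fun t => f t ^ (n + 1)))
      (op_pow (op_comp (op_fun (fun t => 1 / f t)) Dop) (n + 1)) in
  (forall (y : R -> carrier K), derivable_on I (n + 1) y ->
     forall x, I x ->
       op_prod (fun k => op_minus Dop (op_fun (fun t => INR k * m * r t))) n y x
       = T y x)
  /\
  (forall (lam : R), lam <> 0 ->
     forall Y0 : carrier K -> carrier K -> R -> carrier K, y0_form lam K Y0 ->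
       let L : (R -> carrier K) -> (R -> carrier K) :=
         schrodinger_op (fun x =>
                  lam + m ^ 2 * (a ^ 2 + b ^ 2) * INR n * INR (n + 1) / f x ^ 2) in
       let Yn := fun c1 c2 => T (Y0 c1 c2) in
       general_solution I (schrodinger_op (fun _ => lam)) Y0
       /\ (forall c1 c2, solution I L (Yn c1 c2))
       /\ ((forall k : nat, (1 <= k <= n)%nat -> lam <> - m ^ 2 * INR k ^ 2) ->
           general_solution I L Yn))
  /\
  (let L : (R -> carrier K) -> (R -> carrier K) :=
         op_minus (op_plus (op_pow Dop 2)
                              (op_fun (fun _ => m ^ 2 * INR (n + 1) ^ 2)))
              (op_fun (fun x =>
                 INR n * INR (n + 1) * m ^ 2 * (a ^ 2 + b ^ 2) / f x ^ 2)) in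
   (forall (y : R -> carrier K), derivable_on I 2 y ->
      forall x, I x ->
        L y x
        = op_comp (op_plus Dop (op_fun (fun t => m * INR (n + 1) * r t)))
            (op_minus Dop (op_fun (fun t => m * INR (n + 1) * r t))) y x)
   /\
   (forall G : R -> R,
      (forall x, I x -> is_derive G x (/ f x ^ (2 * (n + 1)))) ->
      general_solution I L
        (fun (c1 c2 : carrier K) x =>
           scal (f x ^ (n + 1)) (plus c1 (scal (G x) c2))))).
intros I f r T.
assert (open_I : open I) by apply Rbar_interval_open.
assert (riccati : forall x, I x -> is_derive r x (- m * (r x ^ 2 + 1))).
{ intros x Hx; now apply trig_r_riccati, hf. }
assert (Hf : forall x, I x -> is_derive f x (m * r x * f x)).
{ intros x Hx; now apply trig_f_log_derivative, hf. }
assert (Hsq : forall x, I x -> r x ^ 2 + 1 = (a ^ 2 + b ^ 2) / f x ^ 2).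
{ intros x Hx; now apply trig_r_sqr, hf. }
assert (identity : forall y : R -> carrier K, derivable_on I (n + 1) y ->
          forall x, I x -> ladder_product m r n y x = T y x).
{ exact (ladder_product_eq I open_I m r riccati f hf Hf n). }
split; [exact identity|split].
- intros lam Hlam Y0 HY0 L Yn.
  assert (H0 := general_solution_y0 al be lam K Y0 Hlam HY0); fold I in H0.
  assert (Hpot : forall x, I x ->
    ladder_potential m r lam (INR n * (INR n + 1)) x
    = lam + m ^ 2 * (a ^ 2 + b ^ 2) * INR n * INR (n + 1) / f x ^ 2).
  { intros x Hx; unfold ladder_potential.
    rewrite (Hsq x Hx), plus_INR; simpl INR; field; exact (hf x Hx). }
  assert (HYn : forall c1 c2 x, I x -> ladder_product m r n (Y0 c1 c2) x
                                       = Yn c1 c2 x).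
  { intros c1 c2; apply identity.
    exact (derivable_on_solution_const I lam _ _ open_I (proj1 H0 c1 c2)). }
  assert (Hsol : forall c1 c2, solution I L (Yn c1 c2)).
  { intros c1 c2.
    apply (solution_ext _ open_I _ _ _ _ Hpot (HYn c1 c2)).
    apply (ladder_product_solution _ open_I _ _ riccati), H0. }
  split; [exact H0|split; [exact Hsol|]].
  intros Hres; split; [exact Hsol|].
  intros z Hz.
  destruct (ladder_product_surjective I open_I m r riccati lam n z)
    as [y [Hy E]].
  + intros [|k] Hk; [simpl; lra|].
    intros F; apply (Hres (S k)); [lia|lra].
  + revert Hz; apply (solution_ext _ open_I); [|reflexivity].
    intros x Hx; symmetry; auto.
  + destruct (proj2 H0 y Hy) as [c1 [c2 E0]].
    exists c1, c2; intros x Hx.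
    rewrite (E x Hx), <- (HYn c1 c2 x Hx).
    now apply (ladder_product_ext I open_I m r riccati lam).
- intros L; set (kappa := INR (n + 1)).
  assert (HL : forall (y : R -> carrier K) x, I x ->
    L y x = minus (Dop (Dop y) x)
      (scal (kappa * (kappa - 1) * (m ^ 2 * (r x ^ 2 + 1)) - m ^ 2 * kappa ^ 2)
         (y x))).
  { intros y x Hx.
    unfold L, op_minus, op_plus, op_fun, op_pow; simpl Nat.iter; fold kappa.
    generalize (Dop (Dop y) x) (y x); intros y2 y0.
    rewrite (Hsq x Hx).
    replace (INR n) with (kappa - 1)
      by (unfold kappa; rewrite plus_INR; simpl; ring).
    vector_eq y2 y0; [ring|field; exact (hf x Hx)]. }
  split.
  + intros y Hy x Hx.
    rewrite (HL y x Hx), <- (ladder_factor I m r riccati kappa y x Hy Hx).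
    assert (Ecoef : (fun t => m * kappa * r t) = (fun t => kappa * m * r t)).
    { apply functional_extensionality; intros t; ring. }
    rewrite Ecoef; unfold op_comp, op_plus; fold (ladder (V := carrier K) m r kappa).
    unfold ladder at 1, op_minus at 1, op_fun.
    generalize (ladder m r kappa y); intros u.
    vector_eq (Dop u x) (u x); ring.
  + intros G HG.
    apply (general_solution_op_ext _ (schrodinger_op
             (ladder_potential m r (- (m ^ 2 * kappa ^ 2)) (kappa * (kappa - 1))))).
    * intros z x Hx; rewrite (HL z x Hx).
      unfold schrodinger_op, op_minus, op_fun, op_pow, ladder_potential.
      simpl Nat.iter; generalize (Dop (Dop z) x) (z x); intros z2 z0.
      vector_eq z2 z0; ring.
    * exact (general_solution_resonant al be m r f G (n + 1) riccati hf Hf HG).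
Qed.
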